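(* Let $n,m$ be odd positive integers with $\gcd(n,m)>1$. Then there exists a supermagic labeling of the Cartesian product $C_n\Box C_m$ with the magic constant $c=4nm+2$.
   Context: $C_n$ denotes the cycle on $n$ vertices. The Cartesian product $G_1\Box G_2$ of graphs $G_1,G_2$ with vertex sets $V_1,V_2$ is the graph with vertex set $V_1\times V_2$ in which $(u_1,u_2)$ and $(v_1,v_2)$ are adjacent if and only if either $u_1=v_1$ and $u_2$ is adjacent to $v_2$ in $G_2$, or $u_2=v_2$ and $u_1$ is adjacent to $v_1$ in $G_1$. Let $G$ be a graph with vertex set $V$ and edge set $E$ with $|E|=q$. A supermagic labeling of $G$ is a bijection $f:E\to\{1,2,\dots,q\}$ for which there is a positive integer $c$, called the magic constant, such that for every vertex $x\in V$ the weight $w(x)=\sum_{y:\,xy\in E} f(xy)$ equals $c$. (For $G=C_n\Box C_m$ with $n,m\ge 3$ one has $q=2nm$.) *)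

(* Defs.v *)
From mathcomp Require Import all_boot.

Set Implicit Arguments.
Unset Strict Implicit.
Unset Printing Implicit Defensive.

(* A simple graph on T : finType is given by its adjacency relation, a          *)
(* symmetric irreflexive e : rel T; an edge is the two-element set of its ends. *)

Definition edges (T : finType) (e : rel T) : {set {set T}} :=
  [set [set p.1; p.2] | p : T * T & e p.1 p.2].

(* The vertices are the integers mod n. This is the n-cycle for 3 <= n only:    *)
(* at n = 1 it is a loop and at n = 2 a single edge.                            *)
Definition cycle_rel (n : nat) : rel 'I_n :=
  [rel i j | (ordS i == j) || (ordS j == i)].
Arguments cycle_rel n : clear implicits.

Definition cartesian_rel (T1 T2 : finType) (e1 : rel T1) (e2 : rel T2) :
    rel (T1 * T2) :=
  [rel u v | ((u.1 == v.1) && e2 u.2 v.2) || ((u.2 == v.2) && e1 u.1 v.1)].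

(* The values of f outside [edges e] are irrelevant. *)
Definition edge_labeling (T : finType) (e : rel T) (f : {set T} -> nat) : Prop :=
  [/\ {in edges e, forall a, 1 <= f a <= #|edges e|},
      {in edges e &, injective f}
    & forall k, 1 <= k <= #|edges e| -> exists2 a, a \in edges e & f a = k].

Definition weight (T : finType) (e : rel T) (f : {set T} -> nat) (x : T) : nat :=
  \sum_(y | e x y) f [set x; y].

Definition supermagic (T : finType) (e : rel T) (f : {set T} -> nat) (c : nat) :
    Prop :=
  [/\ edge_labeling e f, 0 < c & forall x, weight e f x = c].

Lemma cycle_rel_sym n : symmetric (cycle_rel n).
Proof. by move=> i j; rewrite /cycle_rel /= orbC. Qed.

Lemma cycle_rel_irr n : 1 < n -> irreflexive (cycle_rel n).
Proof.
move=> n_gt1 i; rewrite /cycle_rel /= orbb; apply/negbTE/eqP => /(congr1 val) /= Ei.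
have := ltn_ord i; rewrite leq_eqVlt => /orP[/eqP ni | lt_in].
  by move: Ei n_gt1; rewrite {1}ni modnn => i0; rewrite -ni -i0.
by move: Ei; rewrite modn_small // => /esym/n_Sn.
Qed.

Lemma cartesian_rel_sym (T1 T2 : finType) (e1 : rel T1) (e2 : rel T2) :
  symmetric e1 -> symmetric e2 -> symmetric (cartesian_rel e1 e2).
Proof.
by move=> s1 s2 u v; rewrite /cartesian_rel /= (eq_sym u.1) (eq_sym u.2) s1 s2.
Qed.

Lemma cartesian_rel_irr (T1 T2 : finType) (e1 : rel T1) (e2 : rel T2) :
  irreflexive e1 -> irreflexive e2 -> irreflexive (cartesian_rel e1 e2).
Proof. by move=> i1 i2 u; rewrite /cartesian_rel /= i1 i2 !andbF. Qed.

(* Main.v *)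
Require Import Defs.
From mathcomp Require Import all_boot zify.

Set Implicit Arguments.
Unset Strict Implicit.
Unset Printing Implicit Defensive.

(** Let d = gcd(n, m) and l = lcm(n, m), both odd, with d * l = n * m and
    d >= 3.  The edges of the torus split into d closed staircases of length
    2l: staircase c (c < d) runs
      P(c,0), P(c+1,0), P(c,1), P(c+1,1), P(c,2), ...
    where P(c,k) = (c + k mod n, k mod m) ([diag]).  By the Chinese remainder
    theorem the points P(c,k), c < d, k < l, list every vertex once
    ([diag_inj], [diag_surj]).  Write h(c,k) for the label of the horizontal
    edge from P(c,k) to P(c+1,k) and v(c,k) for that of the vertical edge from
    P(c+1,k) to P(c,k+1).  The vertex P(c+1,k+1) then has weight
      h(c,k+1) + v(c,k+1) + h(c+1,k+1) + v(c+1,k),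
    the first two terms from staircase c, the last two from staircase c+1.

    Subtract the mean label (2nm+1)/2 from every label, so that the aim is that
    these sums vanish.  Take h(c,k) = A(c,k) + 1/2 and v(c,k) = - h(c,k + s_c),
    where k |-> A(c,k) takes each value of [c * l, (c+1) * l) once per period
    l.  All labels are then used exactly once, whatever the delays s_c
    ([label_range], [label_inj]), and only the weights remain.

    With s_0 = 1 the two terms of staircase 0 at each of its vertices P(0,k)
    cancel, and with s_(d-1) = 0 so do those of staircase d-1 at P(d,k)
    ([label_first], [label_last]).  The points P(d,k) are the points P(0,k') in
    a rotated order, so these cancellations make the closing of the torus
    harmless.  It remains to balance c against c+1 for c+1 < d
    ([label_balance]).

    Two adjacent staircases with delays 1, 0 balance as soon as their sequences
    A differ by a shift of k by one and a constant, and staircases with delays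
    0, 1 always balance; so staircases can be appended in pairs.  As d is odd, a
    block of three must be started with, and there the delays are 1, 2, 0.  With
    p the sequence of the middle staircase the balance conditions force
    A(0,k) = const - p(k) and A(2,k) = const + p(k+1) + p(k+2); hence p must be
    a permutation of the residues mod l whose consecutive sums again fill an
    interval of length l.  Multiplication by 1/2 modulo l has this property
    ([halfmodD]). *)

(** * Halving modulo an odd number *)

Definition halfmod (l k : nat) : nat := (k * uphalf l) %% l.

Lemma halfmod_lt l k : odd l -> halfmod l k < l.
Proof. by move=> l_odd; rewrite ltn_mod odd_gt0. Qed.

Lemma halfmodK l k : odd l -> 2 * halfmod l k = k %[mod l].
Proof.
move=> l_odd; rewrite /halfmod modnMmr.
have two_half : 2 * uphalf l = l.+1 by lia.
by rewrite mulnCA two_half mulnS addnC modnMDl.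
Qed.

Lemma halfmod_inj l k k' :
  odd l -> halfmod l k = halfmod l k' -> k = k' %[mod l].
Proof. by move=> l_odd eq_h; rewrite -halfmodK // eq_h halfmodK. Qed.

Lemma halfmod_modn l k : halfmod l (k %% l) = halfmod l k.
Proof. by rewrite /halfmod modnMml. Qed.

(** Modulo l the two sides agree, as both are k + 1/2 there.  Passing from k to
    k+1 adds l./2 + 1 to the half, or subtracts l./2 when it is at least l./2,
    so that the sum lies in [l./2, l./2 + l) in both cases. *)
Lemma halfmodD l k :
  odd l -> halfmod l k + halfmod l k.+1 = l./2 + k.+1 %% l.
Proof.
move=> l_odd; have lt_h := halfmod_lt k l_odd.
have hS : halfmod l k.+1 = (halfmod l k + uphalf l) %% l.
  by rewrite /halfmod modnDml mulSnr.
have kS : k.+1 %% l = (2 * halfmod l k).+1 %% l.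
  by apply/eqP; rewrite -(addn1 k) -(addn1 (2 * _)) eqn_modDr halfmodK.
rewrite {}hS {}kS; move: (halfmod l k) lt_h => h lt_h.
have [lt_h2 | le_h2] := ltnP h l./2.
  by rewrite !modn_small; lia.
have -> : h + uphalf l = (h - l./2) + l by lia.
have [->|neq_h] := eqVneq h l./2.
  have -> : (2 * l./2).+1 = l by lia.
  by rewrite subnn add0n modnn; lia.
have -> : (2 * h).+1 = ((2 * h).+1 - l) + l by lia.
by rewrite !modnDr !modn_small; lia.
Qed.

(** * The labels *)

(** Staircases 0, 1, 2 form the block of three.  At c = 2 the value is
    halfmod l k.+1 + halfmod l k.+2 - l./2, in the closed form that [halfmodD]
    gives it. *)
Definition offset (l c k : nat) : nat :=
  match c with
  | 0 => l.-1 - halfmod l k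
  | 1 => halfmod l k
  | _ => (k.+1 + ~~ odd c) %% l
  end.

Definition delay (c : nat) : nat :=
  match c with 0 => 1 | 1 => 2 | _ => odd c end.

Lemma offset_lt l c k : odd l -> offset l c k < l.
Proof.
move=> l_odd; have l_gt0 := odd_gt0 l_odd.
case: c => [|[|c]] /=; first by lia.
  exact: halfmod_lt.
by rewrite ltn_mod.
Qed.

Lemma offset_modn l c k : offset l c (k %% l) = offset l c k.
Proof.
case: c => [|[|c]] /=; rewrite ?halfmod_modn //.
by rewrite !addSnnS modnDml.
Qed.

Lemma offset_inj l c k k' :
  odd l -> offset l c k = offset l c k' -> k = k' %[mod l].
Proof.
move=> l_odd; case: c => [|[|c]] /=.
- move=> eq_h; apply: halfmod_inj => //.
  by have := halfmod_lt k l_odd; have := halfmod_lt k' l_odd; lia.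
- exact: halfmod_inj.
by rewrite !addSnnS => /eqP; rewrite eqn_modDr => /eqP.
Qed.

(** The equation of the weights at the vertex common to staircases c and c+1,
    once the constant parts of the labels have cancelled. *)
Lemma offset_balance l c k : odd l ->
  offset l c k.+1 + offset l c.+1 k.+1
    = offset l c (k.+1 + delay c) + offset l c.+1 (k + delay c.+1).
Proof.
move=> l_odd; case: c => [|[|c]] /=.
- have := halfmod_lt k.+1 l_odd; have := halfmod_lt k.+2 l_odd.
  by rewrite addn1 addn2; lia.
- have := halfmodD k.+1 l_odd; have := halfmodD k.+2 l_odd.
  by rewrite addn0 addn2 !addn1; lia.
by case: (odd c) => /=; rewrite ?addn0 ?addn1 // addnC.
Qed.

(** The Boolean b is true on vertical edges.  Horizontal edges take the labels
    above d * l, vertical ones their mirror images at or below it. *)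
Definition label (l d : nat) (b : bool) (c k : nat) : nat :=
  if b then d * l - (c * l + offset l c (k + delay c))
  else (d * l + (c * l + offset l c k)).+1.

Lemma code_lt l d c k : odd l -> c < d -> c * l + offset l c k < d * l.
Proof. by move=> l_odd lt_cd; have := offset_lt c k l_odd; nia. Qed.

(** As an offset is less than l, this is uniqueness of Euclidean division. *)
Lemma code_inj l c c' k k' : odd l ->
  c * l + offset l c k = c' * l + offset l c' k' ->
  c = c' /\ k = k' %[mod l].
Proof.
move=> l_odd eq_code; have l_gt0 := odd_gt0 l_odd.
have eq_c : c = c'.
  have := congr1 (divn^~ l) eq_code.
  by rewrite /= !divnMDl // !divn_small ?offset_lt // !addn0.
by move: eq_code; rewrite -eq_c => /addnI/offset_inj; split=> //; auto.
Qed.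

Lemma label_range l d b c k : odd l -> c < d -> 1 <= label l d b c k <= 2 * (d * l).
Proof.
move=> l_odd lt_cd; have := code_lt k l_odd lt_cd.
by have := code_lt (k + delay c) l_odd lt_cd; case: b => /=; lia.
Qed.

Lemma label_modn l d b c k : label l d b c (k %% l) = label l d b c k.
Proof.
case: b => /=; last by rewrite offset_modn.
by rewrite -offset_modn modnDml offset_modn.
Qed.

Lemma label_inj l d b b' c c' k k' : odd l -> c < d -> c' < d ->
  label l d b c k = label l d b' c' k' ->
  [/\ b = b', c = c' & k = k' %[mod l]].
Proof.
move=> l_odd lt_c lt_c' eq_lab.
have [lt1 lt2] := (code_lt (k + delay c) l_odd lt_c, code_lt (k' + delay c') l_odd lt_c').
case: b b' eq_lab => -[] /= eq_lab; try by exfalso; lia.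
  have /(code_inj l_odd)[eq_c] : c * l + offset l c (k + delay c)
    = c' * l + offset l c' (k' + delay c') by lia.
  by rewrite -eq_c => /eqP; rewrite eqn_modDr => /eqP.
by move: eq_lab => /succn_inj/addnI/(code_inj l_odd)[].
Qed.

Lemma label_balance l d c k : odd l -> c.+1 < d ->
  label l d false c k.+1 + label l d true c k.+1
    + (label l d false c.+1 k.+1 + label l d true c.+1 k) = 4 * (d * l) + 2.
Proof.
move=> l_odd lt_cd; rewrite /label; have := offset_balance c k l_odd.
have := code_lt (k.+1 + delay c) l_odd (ltnW lt_cd).
by have := code_lt (k + delay c.+1) l_odd lt_cd; lia.
Qed.

(** Delay 1 makes the two labels mirror images of each other. *)
Lemma label_first l d k : odd l -> 0 < d ->
  label l d false 0 k.+1 + label l d true 0 k = (2 * (d * l)).+1.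
Proof.
by move=> l_odd d_gt0; have := code_lt k.+1 l_odd d_gt0; rewrite /label addn1; lia.
Qed.

(** The index d.-1 is even and at least 2, so its delay is 0. *)
Lemma label_last l d k : odd l -> odd d -> 1 < d ->
  label l d false d.-1 k + label l d true d.-1 k = (2 * (d * l)).+1.
Proof.
move=> l_odd d_odd d_gt1; have delay0 : delay d.-1 = 0.
  by case: d d_odd d_gt1 => [|[|[|d]]] //= /negbTE->.
have := @code_lt l d d.-1 k l_odd.
by rewrite /label delay0 addn0 prednK ?(ltnW d_gt1) // => /(_ (leqnn _)); lia.
Qed.

(** * Labelings and neighbourhoods in general graphs *)

Lemma set2_inj (T : finType) (a b c d : T) :
  [set a; b] = [set c; d] -> a = c /\ b = d \/ a = d /\ b = c.
Proof.
move=> eq_s.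
have /set2P[] : a \in [set c; d] by rewrite -eq_s set21.
all: have /set2P[] : b \in [set c; d] by rewrite -eq_s set22.
all: have /set2P[] : c \in [set a; b] by rewrite eq_s set21.
all: have /set2P[] : d \in [set a; b] by rewrite eq_s set22.
all: by move=> *; subst; auto.
Qed.

Lemma inj_range_surj (T : finType) (g : T -> nat) :
  injective g -> (forall t, 1 <= g t <= #|T|) ->
  forall k, 1 <= k <= #|T| -> exists t, g t = k.
Proof.
move=> g_inj g_range k k_range.
have uniq_im : uniq (codom g) by rewrite map_inj_uniq ?enum_uniq.
have sub_im : {subset codom g <= iota 1 #|T|}.
  by move=> _ /codomP[t ->]; rewrite mem_iota add1n ltnS.
have [|_ eq_im] := uniq_min_size uniq_im sub_im.
  by rewrite size_iota size_codom.
have : k \in codom g by rewrite eq_im mem_iota add1n ltnS.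
by case/codomP=> t ->; exists t.
Qed.

(** Reduces an edge labeling to a numbering g of any type W that indexes the
    edges without repetition; surjectivity is then a matter of counting. *)
Lemma edge_labeling_of_index (T W : finType) (e : rel T)
    (E : W -> {set T}) (g : W -> nat) :
  (forall a, reflect (exists w, a = E w) (a \in edges e)) -> injective E ->
  injective g -> (forall w, 1 <= g w <= #|W|) ->
  exists2 f : {set T} -> nat, edge_labeling e f & forall w, f (E w) = g w.
Proof.
move=> edgesP E_inj g_inj g_range.
(* The sum has the single term g w at a = E w; this inverts E without choosing
   a default index for the sets that are not edges. *)
pose f (a : {set T}) := \sum_(w | E w == a) g w.
have fE w : f (E w) = g w.
  by rewrite /f (big_pred1 w) // => w'; rewrite /= (inj_eq E_inj).
have card_e : #|edges e| = #|W|.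
  rewrite -(card_imset (mem W) E_inj); apply: eq_card => a.
  by apply/edgesP/imsetP => [[w ->]|[w _ ->]]; exists w.
exists f => //; split=> [_ /edgesP[w ->]|_ _ /edgesP[w ->] /edgesP[w' ->]|k].
- by rewrite card_e fE.
- by rewrite !fE => /g_inj->.
rewrite card_e => /(inj_range_surj g_inj g_range)[w <-].
by exists (E w); rewrite ?fE //; apply/edgesP; exists w.
Qed.

Lemma ordS2_neq n (i : 'I_n) : 2 < n -> ordS (ordS i) != i.
Proof.
move=> n_gt2; apply/eqP => /(congr1 val) /=.
have lt_in := ltn_ord i; have [lt1|le1] := ltnP i.+1 n.
  rewrite (modn_small lt1); have [lt2|le2] := ltnP i.+2 n.
    by rewrite modn_small; lia.
  have eq_n : i.+2 = n by lia.
  by rewrite eq_n modnn; lia.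
have eq_n : i.+1 = n by lia.
by rewrite eq_n modnn modn_small; lia.
Qed.

Lemma ordS_neq n (i : 'I_n) : 2 < n -> ordS i != i.
Proof. by move=> n_gt2; apply: contraNneq (ordS2_neq i n_gt2) => Si; rewrite !Si. Qed.

Lemma sum_cycle_rel n (i : 'I_n) (F : 'I_n -> nat) : 2 < n ->
  \sum_(j | cycle_rel n i j) F j = F (ordS i) + F (ord_pred i).
Proof.
move=> n_gt2; have neq_SP : ord_pred i != ordS i.
  by apply: contraNneq (ordS2_neq i n_gt2) => <-; rewrite ord_predK.
rewrite (bigD1 (ordS i)) /=; last by rewrite /cycle_rel /= eqxx.
rewrite (big_pred1 (ord_pred i)) // => j; rewrite /cycle_rel /=.
have -> : (ordS j == i) = (j == ord_pred i).
  by rewrite -{1}(ord_predK i) (inj_eq (@ordS_inj n)).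
rewrite (eq_sym (ordS i)); have [->|_] := eqVneq j (ordS i).
  by rewrite andbF eq_sym (negbTE neq_SP).
by rewrite andbT.
Qed.

Lemma sum_cartesian_rel (T1 T2 : finType) (e1 : rel T1) (e2 : rel T2)
    (x : T1 * T2) (F : T1 * T2 -> nat) : irreflexive e1 ->
  \sum_(y | cartesian_rel e1 e2 x y) F y
    = \sum_(i | e1 x.1 i) F (i, x.2) + \sum_(j | e2 x.2 j) F (x.1, j).
Proof.
move=> irr1; rewrite (bigID (fun y => x.1 == y.1)) [LHS]addnC /=; congr (_ + _).
  transitivity (\sum_(i | e1 x.1 i) \sum_(j | j == x.2) F (i, j)).
    2: by apply: eq_bigr => i _; rewrite big_pred1_eq.
  rewrite pair_big; apply: eq_big => [y|[]//]; rewrite /cartesian_rel /=.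
  rewrite (eq_sym y.2); case: (x.1 =P y.1) => [<-|_] /=.
    by rewrite andbF irr1.
  by rewrite andbT andbC.
transitivity (\sum_(i | i == x.1) \sum_(j | e2 x.2 j) F (i, j)).
  rewrite pair_big; apply: eq_big => [y|[]//]; rewrite /cartesian_rel /=.
  rewrite (eq_sym y.1); case: (x.1 =P y.1) => [<-|_] /=; last by rewrite andbF.
  by rewrite irr1 andbF orbF andbT.
by rewrite big_pred1_eq.
Qed.

(** * The torus and its staircases *)

Section Torus.

Variables n m : nat.
Hypotheses (n_gt2 : 2 < n) (m_gt2 : 2 < m).

Local Notation V := ('I_n * 'I_m)%type.
Local Notation torus := (cartesian_rel (cycle_rel n) (cycle_rel m)).

Definition right (u : V) : V := (ordS u.1, u.2).
Definition up (u : V) : V := (u.1, ordS u.2).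

(** Both steps of a staircase are indexed by the vertex u where the horizontal
    one starts, so that u = P(c,k) carries h(c,k) and v(c,k). *)
Definition stair_edge (b : bool) (u : V) : {set V} :=
  if b then [set right u; up (right u)] else [set u; right u].

Lemma right_inj : injective right.
Proof.
move=> [i j] [i' j'] /(congr1 (fun v => (ord_pred v.1, v.2))).
by rewrite /= !ordSK.
Qed.

Lemma stair_edge_inj b b' u u' :
  stair_edge b u = stair_edge b' u' -> b = b' /\ u = u'.
Proof.
have h_neq_v v v' : [set v; right v] <> [set v'; up v'].
  by case/set2_inj => -[] /(congr1 fst) /= eq1 /(congr1 fst) /= eq2;
    have := ordS_neq v.1 n_gt2; rewrite eq2 -eq1 eqxx.
case: b b' => -[] //=; last 1 first.
- case/set2_inj => -[] // eq1 eq2; have /eqP[] := ordS2_neq u.1 n_gt2.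
  by have := congr1 fst eq2; rewrite /= => ->; have := congr1 fst eq1.
- case/set2_inj => -[] eq1 eq2; first by split=> //; apply: right_inj.
  have /eqP[] := ordS2_neq (right u).2 m_gt2.
  by have := congr1 snd eq2; rewrite /= => ->; have := congr1 snd eq1.
- by move/esym/h_neq_v.
- by move/h_neq_v.
Qed.

Lemma edges_torusP a :
  reflect (exists w : bool * V, a = stair_edge w.1 w.2) (a \in edges torus).
Proof.
apply: (iffP imsetP) => [[[[i j] [i' j']]]|[[b u] ->]].
  rewrite inE /cartesian_rel /cycle_rel /=.
  case/orP=> /andP[/eqP <-] /orP[]/eqP <- ->.
  - exists (true, (ord_pred i, j)).
    by rewrite /stair_edge /right /up /= ord_predK.
  - exists (true, (ord_pred i, j')).
    by rewrite /stair_edge /right /up /= ord_predK setUC.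
  - by exists (false, (i, j)).
  - by exists (false, (i', j)); rewrite /= setUC.
case: b; [exists (right u, up (right u)) | exists (u, right u)] => //;
  by rewrite inE /cartesian_rel /cycle_rel /= !eqxx ?orbT.
Qed.

(** The vertex lies on two staircases: it is the corner between the steps of u
    on one of them, and follows the steps of y on the other. *)
Lemma weight_torus (f : {set V} -> nat) u y : up (right y) = right u ->
  weight torus f (right u)
    = f (stair_edge false u) + f (stair_edge true u)
      + (f (stair_edge false (right u)) + f (stair_edge true y)).
Proof.
case: u y => [i j] [i' j'] eq_y; rewrite /weight sum_cartesian_rel.
  have eq1 : ordS i' = ordS i := congr1 fst eq_y.
  have eq2 : ordS j' = j := congr1 snd eq_y.
  rewrite !sum_cycle_rel // /stair_edge eq_y /right /up /= ordSK eq1 -eq2 ordSK.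
  rewrite (setUC [set (i, _)]) (setUC [set (_, j')]).
  by rewrite [RHS]addnACA [X in _ = X + _]addnC.
by apply: cycle_rel_irr; lia.
Qed.

Let n_gt0 : 0 < n := ltnW (ltnW n_gt2).
Let m_gt0 : 0 < m := ltnW (ltnW m_gt2).

Definition diag (c k : nat) : V :=
  (Ordinal (ltn_pmod (c + k) n_gt0), Ordinal (ltn_pmod k m_gt0)).

Lemma modn_succ p k : (k %% p).+1 = k.+1 %[mod p].
Proof. by rewrite -!(addn1 (_ %% _)) modnDml addn1. Qed.

Lemma right_diag c k : right (diag c k) = diag c.+1 k.
Proof. by congr (_, _); apply: val_inj; rewrite /= modn_succ. Qed.

Lemma up_diag c k : up (diag c.+1 k) = diag c k.+1.
Proof. by congr (_, _); apply: val_inj; rewrite /= ?modn_succ ?addSnnS. Qed.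

Lemma eqn_mod_lcm a b :
  a = b %[mod n] -> a = b %[mod m] -> a = b %[mod lcmn n m].
Proof.
move=> /eqP + /eqP; wlog le_ba : a b / b <= a => [hw|].
  case/orP: (leq_total b a) => [|le_ab eq_n eq_m]; first exact: hw.
  by apply/esym/hw; rewrite // eq_sym.
by rewrite !eqn_mod_dvd // => n_dv m_dv; apply/eqP; rewrite eqn_mod_dvd ?dvdn_lcm ?n_dv.
Qed.

Lemma diag_class c c' k k' : diag c k = diag c' k' -> c = c' %[mod gcdn n m].
Proof.
case=> eq_n eq_m.
have dvd_mod p a b : gcdn n m %| p -> a = b %[mod p] -> a = b %[mod gcdn n m].
  by move=> d_dv eq_p; rewrite -(modn_dvdm a d_dv) eq_p modn_dvdm.
have /eqP := dvd_mod _ _ _ (dvdn_gcdl n m) eq_n.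
rewrite -modnDmr (dvd_mod _ _ _ (dvdn_gcdr n m) eq_m) modnDmr eqn_modDr.
by move/eqP.
Qed.

Lemma diag_inj c c' k k' : c < gcdn n m -> c' < gcdn n m ->
  diag c k = diag c' k' -> c = c' /\ k = k' %[mod lcmn n m].
Proof.
move=> lt_c lt_c' eq_d; have := diag_class eq_d.
rewrite (modn_small lt_c) (modn_small lt_c') => eq_c; split=> //.
case: eq_d; rewrite -eq_c => /eqP; rewrite eqn_modDl => /eqP eq_n eq_m.
exact: eqn_mod_lcm.
Qed.

(** Counting: the d * l = n * m points with k < l are distinct.  The successor
    keeps the predecessor of k available for naming the vertex one step back
    along the diagonal. *)
Lemma diag_surj u : exists c k, c < gcdn n m /\ u = diag c k.+1.
Proof.
pose g (p : 'I_(gcdn n m) * 'I_(lcmn n m)) := diag p.1 p.2.+1.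
have g_inj : injective g.
  move=> [c k] [c' k'] /(diag_inj (ltn_ord c) (ltn_ord c'))[/val_inj-> /eqP].
  by rewrite /= -!(addn1 (nat_of_ord _)) eqn_modDr !modn_small ?ltn_ord // => /eqP/val_inj->.
have [|h gK hK] := inj_card_bij g_inj.
  by rewrite !card_prod !card_ord [leqRHS]mulnC muln_lcm_gcd.
by exists (h u).1, (h u).2; split; rewrite ?ltn_ord // -[LHS]hK.
Qed.

Lemma diag_modn c k : diag c (k %% lcmn n m) = diag c k.
Proof.
congr (_, _); apply: val_inj => /=.
  by rewrite -modnDmr modn_dvdm ?dvdn_lcml // modnDmr.
by rewrite modn_dvdm ?dvdn_lcmr.
Qed.

Lemma supermagic_torus : odd n -> odd m -> 1 < gcdn n m ->
  exists f, supermagic torus f (4 * n * m + 2).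
Proof.
set d := gcdn n m; set l := lcmn n m => n_odd m_odd d_gt1.
have eq_dl : d * l = n * m by rewrite mulnC muln_lcm_gcd.
have /andP[d_odd l_odd] : odd d && odd l by rewrite -oddM eq_dl oddM n_odd.
have l_gt0 := odd_gt0 l_odd.
pose W := (bool * ('I_d * 'I_l))%type.
pose E (w : W) := stair_edge w.1 (diag w.2.1 w.2.2).
pose g (w : W) := label l d w.1 w.2.1 w.2.2.
have edgesP a : reflect (exists w, a = E w) (a \in edges torus).
  apply: (iffP (edges_torusP a)) => [[[b u] ->]|[w ->]]; last first.
    by exists (w.1, diag w.2.1 w.2.2).
  have [c [k [lt_c ->]]] := diag_surj u.
  exists (b, (Ordinal lt_c, Ordinal (ltn_pmod k.+1 l_gt0))).
  by rewrite /E /= diag_modn.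
have E_inj : injective E.
  move=> [b [c k]] [b' [c' k']] /stair_edge_inj[/= -> /diag_inj].
  by case=> // /val_inj->; rewrite !modn_small ?ltn_ord // => /val_inj->.
have g_inj : injective g.
  move=> [b [c k]] [b' [c' k']] /(label_inj l_odd (ltn_ord c) (ltn_ord c')).
  by rewrite !modn_small ?ltn_ord // => -[/= -> /val_inj-> /val_inj->].
have g_range w : 1 <= g w <= #|{: W}|.
  by rewrite !card_prod card_bool !card_ord label_range.
have [f f_lab fE] := edge_labeling_of_index edgesP E_inj g_inj g_range.
have f_edge b c k : c < d -> f (stair_edge b (diag c k)) = label l d b c k.
  move=> lt_c; have := fE (b, (Ordinal lt_c, Ordinal (ltn_pmod k l_gt0))).
  by rewrite /E /g /= diag_modn label_modn.
exists f; split; rewrite ?addn2 // => x.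
have [u ->] : exists u, x = right u.
  by exists (ord_pred x.1, x.2); rewrite /right /= ord_predK; case: x.
rewrite -mulnA -eq_dl -addn2; have [c [k [lt_c ->]]] := diag_surj u.
(* The vertex P(c+1,k+1) meets staircases c and c+1; when c+1 = d the latter is
   staircase 0, entered at some unknown place k'. *)
have [lt_Sc|le_dSc] := ltnP c.+1 d.
  rewrite (@weight_torus _ _ (diag c.+1 k)); last by rewrite !right_diag up_diag.
  by rewrite right_diag !f_edge // label_balance.
have d_gt0 : 0 < d := ltnW d_gt1.
have eq_c : c = d.-1 by lia.
have [c' [k' [lt_c' eq_x]]] := diag_surj (right (diag c k.+1)).
have c'0 : c' = 0.
  have := diag_class (etrans (esym (right_diag c k.+1)) eq_x).
  by rewrite eq_c prednK // modnn modn_small.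
rewrite (@weight_torus _ _ (diag 0 k')); last first.
  by rewrite right_diag up_diag eq_x c'0.
by rewrite eq_x c'0 !f_edge // eq_c label_last ?label_first //; lia.
Qed.

End Torus.

Theorem theorem8 (n m : nat) (n_gt0 : 0 < n) (m_gt0 : 0 < m)
  (n_odd : odd n) (m_odd : odd m) (gcd_gt1 : 1 < gcdn n m) :
  exists f : {set 'I_n * 'I_m} -> nat,
    supermagic (cartesian_rel (cycle_rel n) (cycle_rel m)) f (4 * n * m + 2).
Proof.
have gt2 p : 0 < p -> odd p -> gcdn n m %| p -> 2 < p.
  move=> p_gt0 p_odd /(dvdn_leq p_gt0) le_p.
  by have : 1 < p by [exact: leq_trans le_p]; case: p p_odd {p_gt0 le_p} => [|[|[]]].
by apply: supermagic_torus; rewrite ?gt2 ?dvdn_gcdl ?dvdn_gcdr.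
Qed.
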